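(* Let $n\geq 0$ be an integer and let $x$ be a complex number for which every denominator and every base raised to a negative power below is nonzero (this is the case whenever $x\notin\{0,\pm1,\pm\tfrac{1}{\sqrt2},\pm 2i,\pm i\sqrt2\}$). Then $$x\sum_{k=0}^{n}\binom{n}{k}\Bigl(\frac{\sqrt{x^2+4}\,(2x^3-x)}{x^2+2}\Bigr)^{n-1-k}\bigl(\rho(x)-(-1)^{n-k}\sigma(x)\bigr)T_{2k+1}(x)$$ $$=\bigl(2x\sqrt{x^2-1}\bigr)^{n-1}\sum_{k=0}^{n}\binom{n}{k}\Bigl(\frac{2x^2-1}{(x^3+2x)\sqrt{x^2-1}}\Bigr)^{k-1}\bigl(\alpha(x)+(-1)^{n-k}\beta(x)\bigr)F_{2k+1}(x)$$ and $$\frac12\sum_{k=0}^{n}\binom{n}{k}\Bigl(\frac{\sqrt{x^2+4}\,(2x^3-x)}{x^2+2}\Bigr)^{n-1-k}\bigl(\rho(x)-(-1)^{n-k}\sigma(x)\bigr)U_{2k+1}(x)$$ $$=\bigl(2x\sqrt{x^2-1}\bigr)^{n-2}\sum_{k=0}^{n}\binom{n}{k}\Bigl(\frac{2x^2-1}{(x^3+2x)\sqrt{x^2-1}}\Bigr)^{k-1}\bigl(\alpha^2(x)-(-1)^{n-k}\beta^2(x)\bigr)F_{2k+1}(x).$$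
   Context: The Chebyshev polynomials of the first kind $T_n(x)$ and of the second kind $U_n(x)$ are defined by $T_0(x)=1$, $T_1(x)=x$, $T_{n+1}(x)=2xT_n(x)-T_{n-1}(x)$, and $U_0(x)=1$, $U_1(x)=2x$, $U_{n+1}(x)=2xU_n(x)-U_{n-1}(x)$ for $n\ge 1$. The (Catalan) Fibonacci polynomials $F_n(x)$ are defined by $F_0(x)=0$, $F_1(x)=1$, $F_n(x)=xF_{n-1}(x)+F_{n-2}(x)$ for $n\geq 2$. Put $\alpha(x)=x+\sqrt{x^2-1}$, $\beta(x)=x-\sqrt{x^2-1}$, $\rho(x)=\frac{x+\sqrt{x^2+4}}{2}$, $\sigma(x)=\frac{x-\sqrt{x^2+4}}{2}$; $\alpha^2(x)=(\alpha(x))^2$ and $\beta^2(x)=(\beta(x))^2$. Here $\sqrt{x^2-1}$ and $\sqrt{x^2+4}$ denote fixed complex square roots, the same choice being used throughout. Convention: $0^0=1$. *)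

(* Defs.v *)
From HB Require Import structures.
From mathcomp Require Import all_boot all_order all_algebra.
From mathcomp Require Import reals.
From mathcomp Require Import complex.

Set Implicit Arguments.
Unset Strict Implicit.
Unset Printing Implicit Defensive.

Import Order.TTheory GRing.Theory Num.Theory.
Local Open Scope ring_scope.

Section Polynomials.
Variable A : comNzRingType.

Fixpoint chebT (n : nat) : {poly A} :=
  if n is n1.+1 then
    if n1 is n2.+1 then 2%:R *: 'X * chebT n1 - chebT n2 else 'X
  else 1.

Fixpoint chebU (n : nat) : {poly A} :=
  if n is n1.+1 then
    if n1 is n2.+1 then 2%:R *: 'X * chebU n1 - chebU n2 else 2%:R *: 'X
  else 1.

Fixpoint fibP (n : nat) : {poly A} :=
  if n is n1.+1 then
    if n1 is n2.+1 then 'X * fibP n1 + fibP n2 else 1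
  else 0.

End Polynomials.

(* Throughout, s and t stand for the chosen square roots of x^2 - 1 and of
   x^2 + 4; they are parameters, so that either choice is allowed for each. *)
Section Functions.
Variable F : fieldType.
Implicit Types x s t : F.

Definition alpha x s : F := x + s.
Definition beta x s : F := x - s.
Definition rho x t : F := (x + t) / 2%:R.
Definition sigma x t : F := (x - t) / 2%:R.

(* Nonvanishing of the denominators x^2 + 2 and (x^3 + 2 x) s, of the two
   bases raised to the powers n - 1 - k and k - 1 (equal to -1 for k = n and
   k = 0 respectively, whatever n is), and of the base 2 x s raised to the
   powers n - 1 and n - 2.  The last condition, needed only for n <= 1,
   restricts nothing: it follows from (x^3 + 2 x) s != 0 whenever 2 != 0. *)
Definition nonvanishing x s t : bool :=
  [&& x ^+ 2 + 2%:R != 0,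
      (x ^+ 3 + 2%:R * x) * s != 0,
      t * (2%:R * x ^+ 3 - x) / (x ^+ 2 + 2%:R) != 0,
      (2%:R * x ^+ 2 - 1) / ((x ^+ 3 + 2%:R * x) * s) != 0
    & 2%:R * x * s != 0].

End Functions.

(* Main.v *)
(* By the Binet formulas both sums become combinations of binomial expansions
   with summands alpha^(2k), beta^(2k), resp. rho^(2k), sigma^(2k).  Put
   A = t (2 x^3 - x) / (x^2 + 2), D = 2 x s and B = (2 x^2 - 1) / ((x^3 + 2 x) s).
   The four resulting n-th powers agree pairwise because
     D B rho^2   = 2 x^2 - 1 + A,     alpha^2 = 2 x^2 - 1 + D,
     D B sigma^2 = 2 x^2 - 1 - A,     beta^2  = 2 x^2 - 1 - D,
   and the prefactors agree because D B t x = 2 A. *)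

Require Import Defs.
From HB Require Import structures.
From mathcomp Require Import all_boot all_order all_algebra.
From mathcomp Require Import reals.
From mathcomp Require Import complex.
From mathcomp Require Import ring.

Set Implicit Arguments.
Unset Strict Implicit.
Unset Printing Implicit Defensive.

Import Order.TTheory GRing.Theory Num.Theory.
Local Open Scope ring_scope.

(** Induction on two consecutive values. The Binet formulas below all follow from it, both sides
    obeying one recurrence [h]. *)
Lemma second_order_rec_uniq (V : Type) (f g : nat -> V) (h : V -> V -> V) :
  (forall n, f n.+2 = h (f n.+1) (f n)) -> (forall n, g n.+2 = h (g n.+1) (g n)) ->
  f 0%N = g 0%N -> f 1%N = g 1%N -> f =1 g.
Proof.
move=> fE gE fg0 fg1 n; suff: f n = g n /\ f n.+1 = g n.+1 by case.
by elim: n => // n [fgn fgn1]; split=> //; rewrite fE gE fgn fgn1.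
Qed.

(** * Binet formulas *)

Section Binet.
Variables (F : fieldType) (x s t : F).
Hypothesis two_neq0 : 2%:R != 0 :> F.
Hypotheses (hs : s ^+ 2 = x ^+ 2 - 1) (ht : t ^+ 2 = x ^+ 2 + 4%:R).

(** [alpha] and [beta] have sum 2 x and product 1, so both are roots of z^2 = 2 x z - 1. *)
Lemma alpha_expSS n :
  alpha x s ^+ n.+2 = 2%:R * x * alpha x s ^+ n.+1 - alpha x s ^+ n.
Proof. by rewrite !exprS /alpha; ring: hs. Qed.

Lemma beta_expSS n :
  beta x s ^+ n.+2 = 2%:R * x * beta x s ^+ n.+1 - beta x s ^+ n.
Proof. by rewrite !exprS /beta; ring: hs. Qed.

Lemma rho_sqr : rho x t ^+ 2 = x * rho x t + 1.
Proof. by rewrite /rho; field: ht. Qed.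

Lemma sigma_sqr : sigma x t ^+ 2 = x * sigma x t + 1.
Proof. by rewrite /sigma; field: ht. Qed.

Lemma chebT_binet n :
  2%:R * (chebT F n).[x] = alpha x s ^+ n + beta x s ^+ n.
Proof.
apply: (second_order_rec_uniq (f := fun n => 2%:R * (chebT F n).[x])
  (g := fun n => alpha x s ^+ n + beta x s ^+ n)
  (h := fun a b => 2%:R * x * a - b)) => [m|m||].
- by rewrite [chebT _ _]/= -/(chebT F m.+1) hornerD hornerN hornerM hornerZ hornerX; ring.
- by rewrite alpha_expSS beta_expSS; ring.
- by rewrite /= hornerE !expr0; ring.
- by rewrite /= hornerE /alpha /beta; ring.
Qed.

(** The factor 2 s = alpha - beta stays on the left, so nothing is divided by s; likewise t = rho -
    sigma in [fibP_binet]. *)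
Lemma chebU_binet n :
  2%:R * s * (chebU F n).[x] = alpha x s ^+ n.+1 - beta x s ^+ n.+1.
Proof.
apply: (second_order_rec_uniq (f := fun n => 2%:R * s * (chebU F n).[x])
  (g := fun n => alpha x s ^+ n.+1 - beta x s ^+ n.+1)
  (h := fun a b => 2%:R * x * a - b)) => [m|m||].
- by rewrite [chebU _ _]/= -/(chebU F m.+1) hornerD hornerN hornerM hornerZ hornerX; ring.
- by rewrite alpha_expSS beta_expSS; ring.
- by rewrite /= hornerE /alpha /beta; ring.
- by rewrite /= hornerZ hornerX /alpha /beta; ring.
Qed.

Lemma fibP_binet n : t * (fibP F n).[x] = rho x t ^+ n - sigma x t ^+ n.
Proof.
apply: (second_order_rec_uniq (f := fun n => t * (fibP F n).[x])
  (g := fun n => rho x t ^+ n - sigma x t ^+ n)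
  (h := fun a b => x * a + b)) => [m|m||].
- by rewrite [fibP _ _]/= -/(fibP F m.+1) hornerD hornerM hornerX; ring.
- by rewrite -(addn2 m) !exprD rho_sqr sigma_sqr !exprS; ring.
- by rewrite /= hornerE !expr0; ring.
- by rewrite /= hornerE /rho /sigma; field.
Qed.

End Binet.

(** Multiplying out the two brackets gives four sums. The sign (-1)^(n-k) is absorbed into X^(n-k),
    turning X into -X, and each sum is then a binomial expansion. *)
Lemma binomial_sum_signed (A : comPzRingType) (n : nat) (X Y g h u v a b : A) :
  \sum_(k < n.+1) 'C(n, k)%:R * (X ^+ (n - k) * Y ^+ k) *
     (g + (- 1) ^+ (n - k) * h) * (u * a ^+ k + v * b ^+ k)
  = g * u * (X + Y * a) ^+ n + g * v * (X + Y * b) ^+ n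
    + h * u * (Y * a - X) ^+ n + h * v * (Y * b - X) ^+ n.
Proof.
rewrite ![_ - X]addrC !exprDn !mulr_sumr -!big_split /=.
apply: eq_bigr => k _; rewrite -![_ * _ *+ _]mulr_natl.
rewrite !exprMn [(- X) ^+ _]exprNn; ring.
Qed.

(** * Signed binomial sums with integer exponents *)

Section SignedSums.
Variables (F : fieldType) (n : nat) (p q c u v a b : F) (f : nat -> F).
Hypothesis fE : forall k, c * f k = u * a ^+ k + v * b ^+ k.

Lemma signed_sum_expz_sub (A : F) : A != 0 ->
  c * A * (\sum_(k < n.+1) 'C(n, k)%:R * A ^ (n%:Z - 1 - k%:Z) *
             (p - (- 1) ^+ (n - k) * q) * f k)
  = p * u * (A + a) ^+ n + p * v * (A + b) ^+ n
    - q * u * (a - A) ^+ n - q * v * (b - A) ^+ n.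
Proof.
move=> A0; have := binomial_sum_signed n A 1 p (- q) u v a b.
rewrite !mul1r !mulNr => <-; rewrite mulr_sumr; apply: eq_bigr => k _.
(* The exponent is -1 at k = n; splitting off A^-1, which the outer factor A cancels, leaves a
   natural exponent. *)
have -> : A ^ (n%:Z - 1 - k%:Z) = A^-1 * A ^+ (n - k).
  have lekn : (k <= n)%N by rewrite -ltnS.
  by rewrite addrAC subzn // expfzDr // mulrC.
by rewrite -fE expr1n; field.
Qed.

(** Here X = D and Y = D B: D^n splits as D^(n-k) D^k, and the outer factor B raises B^(k-1) to
    B^k. *)
Lemma signed_sum_expz_pred (D B : F) : B != 0 ->
  c * B * (D ^+ n * \sum_(k < n.+1) 'C(n, k)%:R * B ^ (k%:Z - 1) *
             (p + (- 1) ^+ (n - k) * q) * f k)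
  = p * u * (D + D * B * a) ^+ n + p * v * (D + D * B * b) ^+ n
    + q * u * (D * B * a - D) ^+ n + q * v * (D * B * b - D) ^+ n.
Proof.
move=> B0; rewrite -binomial_sum_signed !mulr_sumr.
apply: eq_bigr => k _; have lekn : (k <= n)%N by rewrite -ltnS.
rewrite -fE expfzDr // -{1}(subnK lekn) exprD exprMn -!exprnP exprN1.
by field.
Qed.

End SignedSums.

(** * The two convolution identities *)

Section Convolution.
Variables (F : fieldType) (x s t : F).
Hypothesis two_neq0 : 2%:R != 0 :> F.
Hypotheses (hs : s ^+ 2 = x ^+ 2 - 1) (ht : t ^+ 2 = x ^+ 2 + 4%:R).
Hypothesis nv : nonvanishing x s t.

Let A := t * (2%:R * x ^+ 3 - x) / (x ^+ 2 + 2%:R).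
Let B := (2%:R * x ^+ 2 - 1) / ((x ^+ 3 + 2%:R * x) * s).
Let D := 2%:R * x * s.

Let x_neq0 : x != 0.
Proof. by case/and5P: nv => _ _ _ _; rewrite !mulf_eq0 !negb_or => /andP[/andP[]]. Qed.

Let s_neq0 : s != 0.
Proof. by case/and5P: nv => _ _ _ _; rewrite !mulf_eq0 !negb_or => /andP[]. Qed.

Let x22_neq0 : x ^+ 2 + 2%:R != 0. Proof. by case/and5P: nv. Qed.
Let A_neq0 : A != 0. Proof. by case/and5P: nv. Qed.
Let B_neq0 : B != 0. Proof. by case/and5P: nv. Qed.
Let D_neq0 : D != 0. Proof. by case/and5P: nv. Qed.
Let t_neq0 : t != 0.
Proof. by move: A_neq0; rewrite /A !mulf_eq0 !negb_or => /andP[/andP[]]. Qed.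

Let DBE : D * B * (x ^+ 2 + 2%:R) = 2%:R * (2%:R * x ^+ 2 - 1).
Proof.
have x32 : x ^+ 3 + 2%:R * x = x * (x ^+ 2 + 2%:R) by ring.
by rewrite /D /B x32; field; rewrite x_neq0 s_neq0 x22_neq0.
Qed.

Let AE : 2%:R * A = D * B * t * x.
Proof.
apply: (mulIf x22_neq0).
have -> : D * B * t * x * (x ^+ 2 + 2%:R) = D * B * (x ^+ 2 + 2%:R) * t * x by ring.
by rewrite DBE /A; field.
Qed.

(** Since 2 rho^2 = x^2 + 2 + t x, the two terms on the right come from [DBE] and [AE]
    respectively. *)
Let DB_rho : D * B * rho x t ^+ 2 = 2%:R * x ^+ 2 - 1 + A.
Proof.
apply: (mulfI two_neq0); rewrite mulrDr AE -DBE /rho.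
by field: ht.
Qed.

Let DB_sigma : D * B * sigma x t ^+ 2 = 2%:R * x ^+ 2 - 1 - A.
Proof.
apply: (mulfI two_neq0); rewrite mulrBr AE -DBE /sigma.
by field: ht.
Qed.

Let alpha_sqr : alpha x s ^+ 2 = 2%:R * x ^+ 2 - 1 + D.
Proof. by rewrite /alpha /D; ring: hs. Qed.

Let beta_sqr : beta x s ^+ 2 = 2%:R * x ^+ 2 - 1 - D.
Proof. by rewrite /beta /D; ring: hs. Qed.

Let fib_odd k : t * (fibP F (2 * k + 1)).[x]
  = rho x t * (rho x t ^+ 2) ^+ k + - sigma x t * (sigma x t ^+ 2) ^+ k.
Proof. by rewrite fibP_binet // !(exprD _ (2 * k)) !exprM; ring. Qed.

Let chebT_odd k : 2%:R * (chebT F (2 * k + 1)).[x]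
  = alpha x s * (alpha x s ^+ 2) ^+ k + beta x s * (beta x s ^+ 2) ^+ k.
Proof. by rewrite (chebT_binet hs) !(exprD _ (2 * k)) !exprM; ring. Qed.

(** The index shift in [chebU_binet] makes the exponent 2k + 2, whence the coefficients alpha^2 and
    -beta^2 of the second identity. *)
Let chebU_odd k : 2%:R * s * (chebU F (2 * k + 1)).[x]
  = alpha x s ^+ 2 * (alpha x s ^+ 2) ^+ k
    + - beta x s ^+ 2 * (beta x s ^+ 2) ^+ k.
Proof. by rewrite (chebU_binet hs) -addnS !(exprD _ (2 * k)) !exprM; ring. Qed.

Let powersE : [/\ D + D * B * rho x t ^+ 2 = A + alpha x s ^+ 2,
  D * B * rho x t ^+ 2 - D = A + beta x s ^+ 2,
  D + D * B * sigma x t ^+ 2 = alpha x s ^+ 2 - A &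
  D * B * sigma x t ^+ 2 - D = beta x s ^+ 2 - A].
Proof. by rewrite DB_rho DB_sigma alpha_sqr beta_sqr; split; ring. Qed.

Lemma chebT_fibP_sum n :
  x * (\sum_(k < n.+1) 'C(n, k)%:R * A ^ (n%:Z - 1 - k%:Z) *
         (rho x t - (- 1) ^+ (n - k)%N * sigma x t) * (chebT F (2 * k + 1)%N).[x])
  = D ^ (n%:Z - 1) *
    (\sum_(k < n.+1) 'C(n, k)%:R * B ^ (k%:Z - 1) *
       (alpha x s + (- 1) ^+ (n - k)%N * beta x s) * (fibP F (2 * k + 1)%N).[x]).
Proof.
have := signed_sum_expz_sub n (rho x t) (sigma x t) chebT_odd A_neq0.
have := signed_sum_expz_pred n (alpha x s) (beta x s) fib_odd D B_neq0.
set L := \sum_(k < n.+1) _; set M := \sum_(k < n.+1) _.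
have [-> -> -> ->] := powersE => LE ME.
(* Both sides are now the same four n-th powers, with coefficients the products of rho, -sigma with
   alpha, beta. *)
have LM : 2%:R * A * M = t * B * (D ^+ n * L) by rewrite LE ME; ring.
(* The factor D t B turns x into 2 A on the left, by [AE], and D^(n-1) into D^n on the right. *)
apply: (mulfI (mulf_neq0 D_neq0 (mulf_neq0 t_neq0 B_neq0))).
rewrite expfzDr // exprN1 -exprnP.
transitivity (2%:R * A * M); first by rewrite AE; ring.
by rewrite LM; field.
Qed.

Lemma chebU_fibP_sum n :
  1 / 2%:R * (\sum_(k < n.+1) 'C(n, k)%:R * A ^ (n%:Z - 1 - k%:Z) *
         (rho x t - (- 1) ^+ (n - k)%N * sigma x t) * (chebU F (2 * k + 1)%N).[x])
  = D ^ (n%:Z - 2%:Z) *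
    (\sum_(k < n.+1) 'C(n, k)%:R * B ^ (k%:Z - 1) *
       (alpha x s ^+ 2 - (- 1) ^+ (n - k)%N * beta x s ^+ 2) *
       (fibP F (2 * k + 1)%N).[x]).
Proof.
have := signed_sum_expz_sub n (rho x t) (sigma x t) chebU_odd A_neq0.
have := signed_sum_expz_pred n (alpha x s ^+ 2) (- beta x s ^+ 2) fib_odd D B_neq0.
under eq_bigr => k _ do rewrite mulrN.
set L := \sum_(k < n.+1) _; set M := \sum_(k < n.+1) _.
have [-> -> -> ->] := powersE => LE ME.
have LM : 2%:R * s * A * M = t * B * (D ^+ n * L) by rewrite LE ME; ring.
(* The prefactor D^(n-2) calls for D^2. On the left one D serves in [AE]; the other, halved, is x
   s. *)
apply: (mulfI (mulf_neq0 (mulf_neq0 D_neq0 D_neq0) (mulf_neq0 t_neq0 B_neq0))).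
rewrite expfzDr // -exprnN -exprnP.
transitivity (2%:R * s * A * M).
  by rewrite [2%:R * s]mulrC -(mulrA s) AE {1}/D; field.
by rewrite LM; field.
Qed.

End Convolution.

Theorem theorem6 (R : realType) (x s t : R[i])
    (hs : s ^+ 2 = x ^+ 2 - 1) (ht : t ^+ 2 = x ^+ 2 + 4%:R) :
  (x \notin [:: 0; 1; - 1; 1 / sqrtC 2%:R; - (1 / sqrtC 2%:R);
                2%:R * 'i; - (2%:R * 'i); 'i * sqrtC 2%:R; - ('i * sqrtC 2%:R)] ->
   nonvanishing x s t) /\
  (forall n : nat, nonvanishing x s t ->
    x * (\sum_(k < n.+1) 'C(n, k)%:R *
          (t * (2%:R * x ^+ 3 - x) / (x ^+ 2 + 2%:R)) ^ (n%:Z - 1 - k%:Z) *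
          (rho x t - (- 1) ^+ (n - k)%N * sigma x t) *
          (chebT R[i] (2 * k + 1)%N).[x])
    = (2%:R * x * s) ^ (n%:Z - 1) *
      (\sum_(k < n.+1) 'C(n, k)%:R *
          ((2%:R * x ^+ 2 - 1) / ((x ^+ 3 + 2%:R * x) * s)) ^ (k%:Z - 1) *
          (alpha x s + (- 1) ^+ (n - k)%N * beta x s) *
          (fibP R[i] (2 * k + 1)%N).[x])
    /\
    1 / 2%:R * (\sum_(k < n.+1) 'C(n, k)%:R *
          (t * (2%:R * x ^+ 3 - x) / (x ^+ 2 + 2%:R)) ^ (n%:Z - 1 - k%:Z) *
          (rho x t - (- 1) ^+ (n - k)%N * sigma x t) *
          (chebU R[i] (2 * k + 1)%N).[x])
    = (2%:R * x * s) ^ (n%:Z - 2%:Z) *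
      (\sum_(k < n.+1) 'C(n, k)%:R *
          ((2%:R * x ^+ 2 - 1) / ((x ^+ 3 + 2%:R * x) * s)) ^ (k%:Z - 1) *
          (alpha x s ^+ 2 - (- 1) ^+ (n - k)%N * beta x s ^+ 2) *
          (fibP R[i] (2 * k + 1)%N).[x])).

Proof.
have two_neq0 : 2%:R != 0 :> R[i] by rewrite pnatr_eq0.
split=> [|n nv]; last first.
  by split; [apply: chebT_fibP_sum | apply: chebU_fibP_sum].
rewrite !inE !negb_or => /and5P[x0 x1 xN1 xr /and5P[xNr x2i xN2i xi2 xNi2]].
have sqrt2 : sqrtC 2%:R ^+ 2 = 2%:R :> R[i] by rewrite sqrtCK.
(* Apart from 0, the excluded points come in pairs z, -z, each pair being the roots of one of x^2 -
   1, x^2 + 4, x^2 + 2 and 2 x^2 - 1. *)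
have sqr_neq (z w : R[i]) : x != z -> x != - z -> z ^+ 2 = w -> x ^+ 2 - w != 0.
  by move=> xz xNz <-; rewrite subr_eq0 eqf_sqr negb_or xz.
have s0 : s != 0.
  by rewrite -sqrf_eq0 hs; apply: (sqr_neq 1) => //; rewrite expr1n.
have t0 : t != 0.
  rewrite -sqrf_eq0 ht -[4%:R]opprK; apply: (sqr_neq (2%:R * 'i)) => //.
  by rewrite exprMn sqrCi; ring.
have x22 : x ^+ 2 + 2%:R != 0.
  rewrite -[2%:R]opprK; apply: (sqr_neq ('i * sqrtC 2%:R)) => //.
  by rewrite exprMn sqrCi sqrt2; ring.
have x21 : 2%:R * x ^+ 2 - 1 != 0.
  have -> : 2%:R * x ^+ 2 - 1 = 2%:R * (x ^+ 2 - 1 / 2%:R) by field.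
  apply: mulf_neq0 => //; apply: (sqr_neq (1 / sqrtC 2%:R)) => //.
  by rewrite expr_div_n expr1n sqrt2.
(* With these factorizations every quantity in [nonvanishing] is built by products and quotients
   from 2, x, s, t, x^2 + 2 and 2 x^2 - 1. *)
have x32 : x ^+ 3 + 2%:R * x = x * (x ^+ 2 + 2%:R) by ring.
have x31 : 2%:R * x ^+ 3 - x = x * (2%:R * x ^+ 2 - 1) by ring.
apply/and5P; rewrite x32 x31; split=> //; do ?apply: mulf_neq0 => //.
all: by rewrite invr_eq0; do ?apply: mulf_neq0.
Qed.
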